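(* Let $G$ be a finite simple connected graph and let $w$ be a proper edge colouring of $G$ such that there exist two adjacent vertices $x,y$ of $G$ with different palettes, i.e. $S(x)\neq S(y)$. Then $w$ is sequentially orderable, i.e. there is a total order $\prec$ on $E(G)$ such that $f_{\prec}(u)\neq f_{\prec}(v)$ for every edge $uv\in E(G)$.
   Context: An edge colouring (edge weighting) is a map $w:E(G)\to\mathcal C$ into an arbitrary set $\mathcal C$ of colours; it is proper if any two distinct edges sharing an endpoint receive distinct colours. The palette of a vertex $v$ is the set $S(v)=\{w(vu): u\in N(v)\}$. Given a total order $\prec$ on $E(G)$, the vertex colouring induced by $w$ and $\prec$ assigns to each vertex $v$ of degree $d(v)$ the finite sequence $f_{\prec}(v)=(w(e_1),\dots,w(e_{d(v)}))$, where $e_1\prec\dots\prec e_{d(v)}$ are all the edges incident with $v$. The colouring $w$ is called sequentially orderable if there is a total order $\prec$ on $E(G)$ for which $f_{\prec}$ is a proper vertex colouring, i.e. $f_{\prec}(u)\ne f_{\prec}(v)$ for all adjacent $u,v$ (sequences of different lengths are different). *)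

(* Defs.v *)
From mathcomp Require Import all_boot.
From mathcomp Require Import boolp classical_sets.

Set Implicit Arguments.
Unset Strict Implicit.
Unset Printing Implicit Defensive.

(* A finite simple graph is a symmetric irreflexive relation [e] on a finite
   type [T]; its edges are the unordered pairs [[set u; v]] with [e u v]. *)
Definition edge_set (T : finType) (e : rel T) : {set {set T}} :=
  [set [set u; v] | u in T, v in T & e u v].

Definition edge (T : finType) (e : rel T) : finType :=
  {A : {set T} | A \in edge_set e}.

Lemma edge_of_subproof (T : finType) (e : rel T) (u v : T) :
  e u v -> [set u; v] \in edge_set e.
Proof. by move=> euv; apply/imset2P; exists u v; rewrite ?inE. Qed.

Definition edge_of (T : finType) (e : rel T) (u v : T) (euv : e u v) : edge e :=
  exist _ [set u; v] (edge_of_subproof euv).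

Definition incident (T : finType) (e : rel T) (v : T) (a : edge e) : bool :=
  v \in val a.

Definition connected_graph (T : finType) (e : rel T) : Prop :=
  forall u v : T, connect e u v.

Definition proper_edge_colouring (T : finType) (e : rel T) (C : Type)
    (w : edge e -> C) : Prop :=
  forall (a b : edge e) (v : T),
    a != b -> incident v a -> incident v b -> w a <> w b.

Definition palette (T : finType) (e : rel T) (C : Type) (w : edge e -> C)
    (v : T) : set C :=
  [set c | exists (u : T) (evu : e v u), c = w (edge_of evu)]%classic.

(* A total order is given by its reflexive (non-strict) relation. *)
Definition total_order (X : Type) (le : rel X) : Prop :=
  [/\ reflexive le, antisymmetric le, transitive le & total le].

Definition induced_colouring (T : finType) (e : rel T) (C : Type)
    (w : edge e -> C) (le : rel (edge e)) (v : T) : seq C :=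
  [seq w a | a <- sort le (enum [pred a : edge e | incident v a])].

Definition sequentially_orderable (T : finType) (e : rel T) (C : Type)
    (w : edge e -> C) : Prop :=
  exists le : rel (edge e),
    total_order le /\
    forall u v : T, e u v ->
      induced_colouring w le u <> induced_colouring w le v.

(* Main.v *)
(* Grow a connected vertex set V from {x, y}; when v joins V, append the edges
   from v back to V, so that f(v) begins with these edges, while each back
   neighbour u merely gets one more entry.  Choosing which back edges come first
   and second makes f(v) and f(u) differ within their first two entries, unless
   u and v have equal palettes and u had a single edge so far; one such u can
   always be accommodated.  Two of them are avoided by choosing v so that at
   most two vertices r, u of V have both a single neighbour in V and a neighbour
   outside V ("leaves"), and S(r) <> S(u).  If every outside neighbour v of u has
   S(v) = S(r) and every outside neighbour v' of r has S(v') = S(u), adding such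
   a v and then such a v' restores the invariant with v, v' as the new leaves. *)
Require Import Defs.
From mathcomp Require Import all_boot.
From mathcomp Require Import boolp classical_sets.

Set Implicit Arguments.
Unset Strict Implicit.
Unset Printing Implicit Defensive.

(* No common extension: prefixes that diverge stay distinct whatever is appended
   later. *)
Definition diverge (C : Type) (s t : seq C) : Prop :=
  forall s' t', s ++ s' <> t ++ t'.

Lemma diverge_sym (C : Type) (s t : seq C) : diverge s t -> diverge t s.
Proof. by move=> st s' t' eqts; apply: (st t' s'). Qed.

Lemma diverge_cat (C : Type) (s t s' t' : seq C) :
  diverge s t -> diverge (s ++ s') (t ++ t').
Proof. by move=> st x y; rewrite -!catA; apply: st. Qed.

(** * Choosing the order of the back edges of a new vertex *)

(** Pigeonhole: if each [c u] were the [h]-value of two members of [N], picking the first of them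
    would be an injective, hence surjective, self-map of [N]. The second pick for [x0] is then the
    first pick for some [u], which forces [u = x0]. *)
Lemma sparse_fibre (T : finType) (C : Type) (N : {set T}) (c : T -> C)
    (h : T -> C -> Prop) :
  N != finset.set0 ->
  {in N &, forall u v, c u = c v -> u = v} ->
  (forall u a b, h u a -> h u b -> a = b) ->
  exists2 u1, u1 \in N &
    {in N &, forall u u', h u (c u1) -> h u' (c u1) -> u = u'}.
Proof.
move=> /set0Pn[x0 Nx0] c_inj h_fun; apply: contrapT => no_u1.
have two u1 : exists p : T * T, u1 \in N ->
    [/\ p.1 \in N, p.2 \in N, h p.1 (c u1), h p.2 (c u1) & p.1 <> p.2].
  apply: contrapT => no_p; apply: no_u1; exists u1.
    by apply: contrapT => Nu1; apply: no_p; exists (x0, x0) => /Nu1.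
  move=> u u' Nu Nu' hu hu'; apply: contrapT => neq_uu'.
  by apply: no_p; exists (u, u').
have [g gP] := choice two.
pose g1 u := (g u).1.
have g1_inj : {in N &, injective g1}.
  move=> u u' Nu Nu' eq_g; apply: c_inj => //.
  have [_ _ hu _ _] := gP _ Nu; have [_ _ hu' _ _] := gP _ Nu'.
  by apply: (h_fun (g1 u)) => //; rewrite eq_g.
have g1N : g1 @: N = N.
  apply/eqP; rewrite eqEcard card_in_imset // leqnn andbT.
  by apply/fintype.subsetP=> _ /imsetP[u /gP[? _ _ _ _] ->].
have [_ Ng2 hg1 hg2 neq_g] := gP _ Nx0.
move: (Ng2); rewrite -g1N => /imsetP[u Nu eq_g2]; have [_ _ hgu _ _] := gP _ Nu.
suff eq_u : u = x0 by apply: neq_g; rewrite eq_g2 eq_u.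
by apply: c_inj => //; apply: (h_fun (g x0).2) => //; rewrite eq_g2.
Qed.

(* [A u] lists the edges at [u] already ordered and [c u] is the colour of the
   edge joining [u] to the new vertex.  It is enough to control the first two
   entries of the new sequence. *)
Lemma order_back_edges (T : finType) (E : eqType) (C : Type) (w : E -> C)
    (N : {set T}) (c : T -> C) (A : T -> seq E) (bad : T -> Prop) :
  N != finset.set0 ->
  {in N &, forall u v, c u = c v -> u = v} ->
  {in N, forall u, A u != [::]} ->
  {in N, forall u, {in A u, forall a, w a <> c u}} ->
  {in N &, forall u v, bad u -> bad v -> size (A u) = 1 -> size (A v) = 1 ->
     u = v} ->
  exists us : seq T, [/\ uniq us, us =i N &
    {in N, forall u, bad u ->
       diverge ([seq w a | a <- A u] ++ [:: c u]) [seq c x | x <- us]}].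
Proof.
move=> N0 c_inj A_neq0 wA few.
(* At most one [d] in [N] has a sequence beginning with [c u1]; if [u1] goes first, all others
   diverge at the first entry. *)
have [] := @sparse_fibre T C N c (fun u a => ohead [seq w x | x <- A u] = Some a)
  N0 c_inj.
  by move=> u a b -> [].
move=> u1 Nu1 fibre.
have head_div u v vs : u \in N -> ohead [seq w x | x <- A u] <> Some (c v) ->
    diverge ([seq w a | a <- A u] ++ [:: c u]) [seq c x | x <- v :: vs].
  move=> Nu; case: (A u) (A_neq0 u Nu) => // a l _ /= neq s' t' [eq_c _].
  by apply: neq; rewrite eq_c.
have self_div u vs : u \in N ->
    diverge ([seq w a | a <- A u] ++ [:: c u]) [seq c x | x <- u :: vs].
  move=> Nu; apply: head_div => //; move: (wA u Nu) (A_neq0 u Nu).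
  by case: (A u) => // a l wAu _ [] /wAu; apply; rewrite mem_head.
have snd_div u v vs : u \in N -> size (A u) <> 1 ->
    diverge ([seq w a | a <- A u] ++ [:: c u]) [seq c x | x <- v :: u :: vs].
  move=> Nu; move: (wA u Nu) (A_neq0 u Nu).
  case: (A u) => // a [//|b l] wAu _ _ s' t' [_ eq_c _].
  by apply: (wAu b) => //; rewrite !inE eqxx orbT.
have trd_div u v v' vs : u \in N -> v' \in N -> u != v' -> size (A u) = 1 ->
    diverge ([seq w a | a <- A u] ++ [:: c u]) [seq c x | x <- v :: v' :: vs].
  move=> Nu Nv' /eqP neq; case: (A u) => // a [|//] _ s' t' [_ eq_c _].
  by apply: neq; apply: c_inj.
case: (EM (exists2 u, u \in N & ohead [seq w x | x <- A u] = Some (c u1)))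
    => [[d Nd hd]|nod]; last first.
  exists (u1 :: enum (N :\ u1)); split.
  - by rewrite /= enum_uniq mem_enum !inE eqxx.
  - by move=> z; rewrite inE mem_enum !inE; case: eqP => // ->.
  - by move=> u Nu _; apply: head_div => // hu; apply: nod; exists u.
have dNu1 : d != u1.
  apply/eqP=> eq_d; move: hd (A_neq0 d Nd) (wA d Nd); rewrite -eq_d.
  by case: (A d) => // a l [eq_c] _ /(_ a (mem_head _ _)).
have others u vs : u \in N -> u != d ->
    diverge ([seq w a | a <- A u] ++ [:: c u]) [seq c x | x <- u1 :: vs].
  by move=> Nu /eqP neq; apply: head_div => // hu; apply: neq; apply: fibre.
pose rest := enum (N :\ u1 :\ d).
have restE z : (z \in rest) = [&& z != d, z != u1 & z \in N].
  by rewrite mem_enum !inE.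
have rest_uniq : uniq rest by exact: enum_uniq.
(* If [d] has two earlier edges, it may go second: its second edge does not have colour [c d]. *)
case: (EM (bad d /\ size (A d) = 1)) => [[bad_d size_d]|safe_d]; last first.
  exists [:: u1, d & rest]; split.
  - by rewrite /= !inE !restE !eqxx rest_uniq /= andbF orbF eq_sym dNu1.
  - move=> z; rewrite !inE restE.
    by case: (eqVneq z u1) => [->|_] //=; case: (eqVneq z d) => [->|].
  - move=> u Nu bad_u; case: (eqVneq u d) bad_u => [-> bad_d|neq_ud _].
      by apply: snd_div => // size_d; apply: safe_d.
    exact: others Nu neq_ud.
(* Now the second entry at [d] is [c d], so any third vertex [r] can go second. If there is none,
   [d] goes first, and [u1], when bad, has at least two earlier edges by [few]. *)
case def_rest: rest restE rest_uniq => [|r rest'] restE rest_uniq.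
  exists [:: d; u1]; split.
  - by rewrite /= inE dNu1.
  - move=> z; rewrite !inE; case: (eqVneq z d) => [->|neq_zd] //=.
    by case: (eqVneq z u1) (restE z) => [->|_] //; rewrite neq_zd in_nil.
  - move=> u Nu bad_u; case: (eqVneq u d) => [->|neq_ud]; first exact: self_div.
    have -> : u = u1.
      by apply/eqP; have:= restE u; rewrite neq_ud Nu andbT; case: eqP.
    apply: snd_div => // size_u1; move/eqP: dNu1; apply; apply: few => //.
    by have:= restE u; rewrite neq_ud Nu andbT in_nil; case: eqP bad_u => // ->.
have := restE r; rewrite mem_head => /esym/and3P[rd ru1 Nr].
exists [:: u1, r, d & rest']; split.
- have:= restE d; have:= restE u1; rewrite !eqxx /= andbF !inE.
  move=> /norP[u1r u1rest] /norP[dr drest]; move: rest_uniq => /= /andP[rrest ->].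
  by rewrite !negb_or u1r u1rest drest rd rrest eq_sym dNu1.
- move=> z; have:= restE z; rewrite !inE.
  case: (eqVneq z u1) => [->|_] //=; case: (eqVneq z d) => [->|_] /=.
    by rewrite orbT.
  by move->.
- move=> u Nu bad_u; case: (eqVneq u d) => [->|neq_ud]; last exact: others Nu neq_ud.
  by apply: trd_div => //; rewrite eq_sym.
Qed.

(** * Edges, partial sequences and palettes *)

Section Growth.

Variables (T : finType) (e : rel T) (C : Type) (w : edge e -> C) (a0 : edge e).
Hypotheses (e_sym : symmetric e) (e_irr : irreflexive e).
Hypothesis w_proper : proper_edge_colouring w.

(** Total, so that no adjacency proof is carried along; [a0] is the default value on non-adjacent
    pairs. *)
Definition joint (u v : T) : edge e := insubd a0 [set u; v].

Lemma val_joint u v : e u v -> val (joint u v) = [set u; v].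
Proof. by move=> euv; rewrite insubdK // edge_of_subproof. Qed.

Lemma jointP (a : edge e) : exists u v, e u v /\ a = joint u v.
Proof.
case/imset2P: (valP a) => u v _; rewrite inE => euv def_a.
by exists u, v; split=> //; apply: val_inj; rewrite val_joint.
Qed.

Lemma jointC u v : joint u v = joint v u.
Proof. by rewrite /joint finset.setUC. Qed.

Lemma incident_joint u v z :
  e u v -> incident z (joint u v) = (z == u) || (z == v).
Proof. by move=> euv; rewrite /incident val_joint // !inE. Qed.

Lemma joint_inj u v v' : e u v -> e u v' -> joint u v = joint u v' -> v = v'.
Proof.
move=> euv euv' eq_j; have:= incident_joint v euv.
rewrite eq_j incident_joint // eqxx orbT => /orP[] /eqP // eq_v.
by rewrite eq_v e_irr in euv.
Qed.

Definition partial (L : seq (edge e)) (v : T) : seq C :=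
  [seq w a | a <- L & incident v a].

(** Vertices with different palettes are thus separated by every order, which leaves only edges with
    equal palettes to control. *)
Lemma palette_partial L v : (forall a, a \in L) ->
  palette w v = [set c | has (fun c' => `[<c = c'>]) (partial L v)]%classic.
Proof.
move=> L_full; apply/seteqP; split=> [c [u [evu ->]]|c] /=; rewrite has_map.
  apply/hasP; exists (edge_of evu); last exact/asboolP.
  by rewrite mem_filter L_full /incident /= !inE eqxx.
case/hasP=> a; rewrite mem_filter L_full andbT => va /asboolP->.
have [p [q [epq def_a]]] := jointP a; move: va; rewrite def_a incident_joint //.
case/orP=> /eqP->; [exists q, epq|have eqp : e q p by rewrite e_sym];
  last (exists p, eqp; rewrite jointC);
  by congr w; apply: val_inj; rewrite val_joint.
Qed.

(** * Adding one vertex to an ordered vertex set *)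

(** The invariant of the growth. Palettes are those of the whole graph; [ordered_nbr] gives every
    sequence a first entry to compare with. *)
Record ordered_on (V : {set T}) (L : seq (edge e)) : Prop := OrderedOn {
  ordered_uniq : uniq L;
  ordered_mem : forall a, (a \in L) = (val a \subset V);
  ordered_nbr : {in V, forall u, exists2 v, v \in V & e u v};
  ordered_diverge : {in V &, forall u v, e u v ->
    palette w u = palette w v -> diverge (partial L u) (partial L v)} }.

Definition leaf (V : {set T}) (u : T) : Prop :=
  [/\ u \in V, {in V &, forall a b, e u a -> e u b -> a = b}
    & exists2 z, z \notin V & e u z].

Lemma joint_sub (V : {set T}) u v :
  e u v -> (val (joint u v) \subset V) = (u \in V) && (v \in V).
Proof. by move=> euv; rewrite val_joint // finset.subUset !finset.sub1set. Qed.

(** Old pairs stay divergent under appending, so only pairs with [v] matter; [order_back_edges]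
    handles them, bad meaning that the palette is that of [v]. *)
Lemma extend V L v :
  ordered_on V L -> v \notin V -> (exists2 u, u \in V & e u v) ->
  (forall u1 u2, leaf V u1 -> leaf V u2 -> e u1 v -> e u2 v ->
     palette w u1 = palette w v -> palette w u2 = palette w v -> u1 = u2) ->
  exists L', ordered_on (v |: V) L'.
Proof.
move=> [L_uniq L_mem L_nbr L_div] NVv [u0 Vu0 eu0v] few.
pose N := [set u in V | e u v]; pose c u := w (joint u v).
pose A u := [seq a <- L | incident u a].
have NP u : u \in N -> u \in V /\ e u v by rewrite inE => /andP.
have [||||| us [us_uniq us_mem us_div]] := @order_back_edges T (edge e) C w N c A
    (fun u => palette w u = palette w v).
- by apply/set0Pn; exists u0; rewrite inE Vu0.
- move=> u u' /NP[_ euv] /NP[_ eu'v] eq_c; apply: (@joint_inj v); rewrite 1?e_sym //.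
  rewrite ![joint v _]jointC; apply: contrapT => /eqP neq.
  by apply: (w_proper (v := v) neq) => //; rewrite incident_joint ?eqxx ?orbT.
- move=> u /NP[Vu _]; have [z Vz euz] := L_nbr u Vu.
  have: joint u z \in A u.
    by rewrite mem_filter incident_joint ?eqxx // L_mem joint_sub // Vu.
  by case: (A u).
- move=> u /NP[Vu euv] a; rewrite mem_filter L_mem => /andP[ua aV].
  apply: (w_proper (v := u)) => //; last by rewrite incident_joint ?eqxx.
  by apply: contraNneq NVv => eq_a; move: aV; rewrite eq_a joint_sub // => /andP[].
(* A single listed edge means a single neighbour in [V], and [v] is a neighbour outside. *)
- have leafN u : u \in N -> size (A u) = 1 -> leaf V u.
    move=> /NP[Vu euv] size_u; split=> //; last by exists v.
    move=> a b Va Vb eua eub; apply: (joint_inj eua eub).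
    have: joint u a \in A u.
      by rewrite mem_filter incident_joint ?eqxx // L_mem joint_sub // Vu.
    have: joint u b \in A u.
      by rewrite mem_filter incident_joint ?eqxx // L_mem joint_sub // Vu.
    by case: (A u) size_u => [|x []] // _; rewrite !inE => /eqP-> /eqP->.
  move=> u u' Nu Nu' eq_u eq_u' size_u size_u'.
  by apply: few => //; [apply: leafN|apply: leafN|case: (NP _ Nu)|case: (NP _ Nu')].
pose B := [seq joint u v | u <- us].
have usP u : u \in us -> u \in V /\ e u v by rewrite us_mem => /NP.
have LB u : partial (L ++ B) u = partial L u ++ partial B u.
  by rewrite /partial filter_cat map_cat.
have Lv : partial L v = [::].
  rewrite /partial (@eq_in_filter _ _ pred0) ?filter_pred0 // => a.
  rewrite L_mem => aV; apply: contraNF NVv => va; exact: (fintype.subsetP aV).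
have Bv : partial B v = [seq c u | u <- us].
  rewrite /partial (@eq_in_filter _ _ predT) ?filter_predT -?map_comp //.
  by move=> _ /mapP[u /usP[_ euv] ->]; rewrite incident_joint // eqxx orbT.
have Bu u : u \in N -> partial B u = [:: c u].
  move=> Nu; have [Vu euv] := NP _ Nu.
  rewrite /partial filter_map -map_comp (@eq_in_filter _ _ (pred1 u)).
    by rewrite filter_pred1_uniq // us_mem.
  move=> u' /usP[_ eu'v] /=; rewrite incident_joint // eq_sym.
  by case: (u =P v) => [eq_u|]; rewrite ?orbF //; case/negP: NVv; rewrite -eq_u.
have vdiv u : u \in V -> e u v -> palette w u = palette w v ->
    diverge (partial (L ++ B) u) (partial (L ++ B) v).
  move=> Vu euv eq_u; have Nu : u \in N by rewrite inE Vu.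
  by rewrite !LB Lv Bv Bu //; apply: us_div.
exists (L ++ B); split.
- rewrite cat_uniq L_uniq map_inj_in_uniq ?us_uniq ?andbT.
    apply/hasPn=> _ /mapP[u /usP[_ euv] ->].
    by rewrite L_mem joint_sub // (negPf NVv) andbF.
  move=> u u' /usP[_ euv] /usP[_ eu'v]; rewrite ![joint _ v]jointC.
  by apply: joint_inj; rewrite e_sym.
- move=> a; rewrite mem_cat L_mem; have [p [q [epq ->]]] := jointP a.
  rewrite !joint_sub // !in_setU1.
  apply/idP/idP => [/orP[/andP[-> ->]|/mapP[u /usP[Vu euv]]]|].
  + by rewrite !orbT.
  + move/(congr1 (fun a : edge e => (val a \subset v |: V) : bool)).
    by rewrite !joint_sub // !in_setU1 Vu eqxx orbT /= => ->.
  case/andP; case: (eqVneq p v) => [eq_p _|_ /= Vp].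
    case: (eqVneq q v) => [eq_q|_ /= Vq]; first by rewrite eq_p eq_q e_irr in epq.
    apply/orP; right; apply/mapP; exists q; last by rewrite eq_p jointC.
    by rewrite us_mem inE Vq e_sym -eq_p.
  case: (eqVneq q v) => [eq_q _|_ /= Vq]; last by rewrite Vp Vq.
  by apply/orP; right; apply/mapP; exists p; rewrite ?us_mem ?inE ?Vp -?eq_q.
- move=> u; rewrite in_setU1; case: eqP => [-> _|_ /= Vu].
    by exists u0; rewrite ?in_setU1 ?Vu0 ?orbT // e_sym.
  by have [z Vz euz] := L_nbr u Vu; exists z; rewrite ?in_setU1 ?Vz ?orbT.
- move=> p q; rewrite !in_setU1.
  case: (eqVneq p v) => [-> _|_ /= Vp]; case: (eqVneq q v) => [-> _|_ /= Vq] epq.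
  + by rewrite e_irr in epq.
  + by move=> eq_q; apply/diverge_sym/vdiv; rewrite 1?e_sym.
  + exact: vdiv.
  by move=> eq_pq; rewrite !LB; apply/diverge_cat/L_div.
Qed.

(** * Controlling the leaves during the growth *)

(** An old vertex already has a neighbour in [V]; adjacency to [v] gives it a second one, so it is
    no longer a leaf. *)
Lemma leaf_extend V L v z :
  ordered_on V L -> v \notin V -> leaf (v |: V) z ->
  z = v \/ leaf V z /\ ~~ e z v.
Proof.
move=> [_ _ V_nbr _] NVv [Vz z_uniq [t Vt ezt]].
move: Vz; rewrite in_setU1; case: eqP => [|_ /= Vz]; first by left.
have sub x : x \in V -> x \in v |: V by rewrite in_setU1 orbC => ->.
right; split.
  split=> //; first by move=> a b Va Vb; apply: z_uniq; apply: sub.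
  by exists t => //; apply: contra Vt; apply: sub.
apply/negP=> ezv; have [a Va eza] := V_nbr z Vz.
move/negP: NVv; apply; suff <- : a = v by [].
by apply: z_uniq => //; [apply: sub | rewrite in_setU1 eqxx].
Qed.

Lemma crossing_edge (V : {set T}) :
  connected_graph e -> V != finset.set0 -> V != [set: T]%SET ->
  exists u v, [/\ u \in V, v \notin V & e u v].
Proof.
move=> e_conn /set0Pn[x Vx] VT; apply: contrapT => no_uv.
have V_step u v : u \in V -> e u v -> v \in V.
  by move=> Vu euv; apply: contrapT => /negP Vv; apply: no_uv; exists u, v.
have V_closed : closed e (mem V).
  move=> u v euv; apply/idP/idP => [Vu|Vv]; first exact: V_step euv.
  by apply: V_step Vv _; rewrite e_sym.
move/negP: VT; apply; apply/eqP/setP=> y; rewrite finset.in_setT.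
by rewrite -(closed_connect V_closed (e_conn x y)).
Qed.

(** The palette of [v] agrees with that of at most one of [r] and [u]. *)
Lemma extend_two V L r u v :
  ordered_on V L -> palette w r <> palette w u ->
  (forall z, leaf V z -> z = r \/ z = u) ->
  v \notin V -> (exists2 p, p \in V & e p v) ->
  exists L', ordered_on (v |: V) L'.
Proof.
move=> ord neq two NVv Vv; apply: (extend ord) => // u1 u2 l1 l2 _ _ eq1 eq2.
case: (two _ l1) (two _ l2) eq1 eq2 => -> [] -> // eq1 eq2; case: neq;
  by rewrite eq1 eq2.
Qed.

(** Induction on the number of vertices outside [V]. The pair [r], [u] only bounds the set of
    leaves; neither has to be one. *)
Lemma grow V L r u :
  connected_graph e -> V != finset.set0 -> ordered_on V L ->
  palette w r <> palette w u ->
  (forall z, leaf V z -> z = r \/ z = u) ->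
  exists L', ordered_on [set: T]%SET L'.
Proof.
move=> e_conn; have [n] := ubnP #|~: V|; elim: n => // n IHn in V L r u *.
move=> ltVn V0 ord neq two.
have [VT|VT] := eqVneq V [set: T]%SET; first by exists L; rewrite -VT.
have next (V' : {set T}) L' v r' u' : v \notin V -> v |: V \subset V' ->
    ordered_on V' L' -> palette w r' <> palette w u' ->
    (forall z, leaf V' z -> z = r' \/ z = u') ->
    exists L'', ordered_on [set: T]%SET L''.
  move=> NVv sub ord' neq' two'.
  have V'v : v \in V' by apply: (fintype.subsetP sub); rewrite in_setU1 eqxx.
  apply: (IHn V' L' r' u') => //; last by apply/set0Pn; exists v.
  rewrite -ltnS; apply: leq_trans ltVn; rewrite ltnS; apply: proper_card.
  rewrite properC; apply/properP; split; last by exists v.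
  by apply: fintype.subset_trans sub; apply: finset.subsetUr.
(* Supplies a dummy companion when only one leaf is possible. *)
have other p : exists q, palette w p <> palette w q.
  case: (EM (palette w p = palette w r)) => [->|]; first by exists u.
  by exists r.
(* If [v] is adjacent to every leaf, it becomes the only possible leaf. *)
have add_one p v : v \notin V -> p \in V -> e p v ->
    (forall z, leaf V z -> ~~ e z v -> False) ->
    exists L', ordered_on [set: T]%SET L'.
  move=> NVv Vp epv dead; have [|L' ord'] := extend_two ord neq two NVv.
    by exists p.
  have [q neq_q] := other v.
  apply: (next (v |: V) L' v v q) => // z lz; left.
  by case: (leaf_extend ord NVv lz) => // -[/dead].
case: (EM (leaf V u)) => [lu|Nlu]; last first.
  case: (EM (leaf V r)) => [[Vr _ [v NVv erv]]|Nlr].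
    apply: (add_one r v) => // z lz; case: (two z lz) => eq_z.
      by rewrite eq_z erv.
    by case: Nlu; rewrite -eq_z.
  have [p [v [Vp NVv epv]]] := crossing_edge e_conn V0 VT.
  by apply: (add_one p v) => // z lz; case: (two z lz) (lz) => ->.
case: (EM (leaf V r)) => [lr|Nlr]; last first.
  have [Vu _ [v NVv euv]] := lu.
  apply: (add_one u v) => // z lz; case: (two z lz) => eq_z.
    by case: Nlr; rewrite -eq_z.
  by rewrite eq_z euv.
(* Adding [v] replaces [u] by [v] among the possible leaves; adding [v'] replaces [r] by [v']. One
   of these suffices unless [v] has the palette of [r] and [v'] that of [u]. *)
have [Vu _ [v NVv euv]] := lu; have [Vr _ [v' NVv' erv']] := lr.
have [|L1 ord1] := extend_two ord neq two NVv; first by exists u.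
have two1 z : leaf (v |: V) z -> z = r \/ z = v.
  case/(leaf_extend ord NVv) => [|[/two[] -> //]]; [by right|by left|].
  by rewrite euv.
case: (EM (palette w r = palette w v)) => [eq_rv|neq_rv]; last first.
  exact: (next _ _ _ _ _ NVv _ ord1 neq_rv two1).
case: (EM (palette w u = palette w v')) => [eq_uv'|neq_uv']; last first.
  have [|L2 ord2] := extend_two ord neq two NVv'; first by exists r.
  apply: (next _ _ _ _ _ NVv' _ ord2 neq_uv') => // z.
  case/(leaf_extend ord NVv') => [|[/two[] -> //]]; [by right| |by left].
  by rewrite erv'.
have NV1v' : v' \notin v |: V.
  by rewrite in_setU1 negb_or NVv' andbT; apply/eqP=> eq_v; apply: neq;
    rewrite eq_rv eq_uv' eq_v.
(* The possible leaves [r] and [v] of [v |: V] share a palette different from that of [v'], so the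
   condition of [extend] is vacuous. *)
have [|u1 u2 l1 l2 _ _ eq1 eq2|L2 ord2] := extend ord1 NV1v'.
- by exists r; rewrite ?in_setU1 ?Vr ?orbT.
- by case: neq; rewrite eq_uv' -eq1; case: (two1 _ l1) => ->.
apply: (next (v' |: (v |: V)) L2 v v v') => //.
- exact: finset.subsetUr.
- by rewrite -eq_rv -eq_uv'.
move=> z /(leaf_extend ord1 NV1v')[|[/two1[] -> //]]; [by right| |by left].
by rewrite erv'.
Qed.

End Growth.

(** * From the edge list to a total order *)

(** Both sides are sorted by position in [L] and are permutations of each other. This identifies the
    induced colouring with [partial]. *)
Lemma sort_index (X : eqType) (L s : seq X) (P : pred X) :
  uniq L -> (forall a, a \in L) -> uniq s -> s =i P ->
  sort (fun a b => index a L <= index b L) s = filter P L.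
Proof.
move=> L_uniq L_full s_uniq sP; set le := fun a b => _.
have le_trans : transitive le by move=> b a c; apply: leq_trans.
have le_anti : antisymmetric le.
  move=> a b; rewrite -eqn_leq => /eqP eq_i.
  by rewrite -(nth_index a (L_full a)) eq_i nth_index.
have le_total : total le by move=> a b; apply: leq_total.
apply: (sorted_eq le_trans le_anti); first exact: sort_sorted.
  apply: sorted_filter => //; case: L L_uniq @le {L_full le_trans le_anti le_total}.
    by [].
  move=> a L L_uniq le; apply/(sortedP a) => i lt_i.
  by rewrite /le !index_uniq // ltnW.
rewrite perm_sort; apply: uniq_perm => //; first exact: filter_uniq.
by move=> a; rewrite sP mem_filter L_full andbT.
Qed.

Theorem theorem5 (T : finType) (e : rel T) (C : Type) (w : edge e -> C)
  (e_sym : symmetric e) (e_irr : irreflexive e)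
  (e_conn : connected_graph e)
  (w_proper : proper_edge_colouring w)
  (w_palettes : exists x y : T, e x y /\ palette w x <> palette w y) :
  sequentially_orderable w.
Proof.
have [x [y [exy neq]]] := w_palettes; pose a0 := edge_of exy.
(* The divergence condition is vacuous at the start, as [x] and [y] have different palettes. *)
have ord : ordered_on w [set x; y] [:: a0].
  split=> //.
  - move=> a; rewrite inE; have [p [q [epq ->]]] := jointP a0 a.
    rewrite joint_sub // !inE -val_eqE val_joint //=.
    apply/eqP/idP => [eq_pq|].
      by have:= set21 p q; have:= set22 p q; rewrite eq_pq !inE => -> ->.
    case/andP=> /orP[] /eqP eq_p /orP[] /eqP eq_q; move: epq; rewrite eq_p eq_q.
    + by rewrite e_irr.
    + by [].
    + by rewrite finset.setUC.
    + by rewrite e_irr.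
  - by move=> u; rewrite !inE => /orP[] /eqP->; [exists y|exists x];
      rewrite ?inE ?eqxx ?orbT // e_sym.
  - move=> u v; rewrite !inE => /orP[] /eqP-> /orP[] /eqP->;
      rewrite ?e_irr // => _ eq_p; case: neq; by [].
have [||L [L_uniq L_mem _ L_div]] :=
    grow a0 e_sym e_irr w_proper e_conn _ ord neq.
- by apply/set0Pn; exists x; rewrite !inE eqxx.
- by move=> z [+ _ _]; rewrite !inE => /orP[] /eqP; [left|right].
have L_full a : a \in L by rewrite L_mem finset.subsetT.
exists (fun a b => index a L <= index b L); split.
  split.
  - by move=> a; apply: leqnn.
  - move=> a b; rewrite -eqn_leq => /eqP eq_i.
    by rewrite -(nth_index a (L_full a)) eq_i nth_index.
  - by move=> b a c; apply: leq_trans.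
  - by move=> a b; apply: leq_total.
have partialE v : induced_colouring w (fun a b => index a L <= index b L) v =
    partial w L v.
  rewrite /induced_colouring (sort_index (P := incident v)) ?enum_uniq //.
  by move=> a; rewrite mem_enum.
move=> u v euv eq_f.
(* Equal sequences force equal palettes, and then divergence with empty continuations is
   contradicted. *)
have eq_uv : palette w u = palette w v.
  by rewrite !(palette_partial w a0 e_sym _ L_full) -!partialE eq_f.
have:= L_div u v; rewrite !finset.in_setT => /(_ isT isT euv eq_uv).
by move/(_ [::] [::]); rewrite !cats0 -!partialE.
Qed.
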